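(* There exists a transitive t.d.s. $(X,T)$ with zero topological entropy that is Banach-mean equicontinuous (and thus not mean sensitive) such that $(K(X),T_K)$ is mean sensitive and has positive topological entropy.
   Context: A t.d.s. (topological dynamical system) is a pair $(X,T)$ where $X$ is a non-empty compact metric space with metric $d$ and $T\colon X\to X$ is continuous; $\mathbb{N}$ denotes the positive integers. $(X,T)$ is transitive if for all non-empty open $U,V\subset X$ there is $n\in\mathbb{N}$ with $T^nU\cap V\neq\emptyset$. $K(X)$ is the space of non-empty closed subsets of $X$ with the Hausdorff metric $d_H(A,B)=\max\{\max_{x\in A}\min_{y\in B}d(x,y),\max_{y\in B}\min_{x\in A}d(x,y)\}$ (a compact metric space), and $T_K\colon K(X)\to K(X)$, $T_K(C)=T(C)$, is the induced continuous map; so $(K(X),T_K)$ is a t.d.s. $(X,T)$ is Banach-mean equicontinuous if for every $x\in X$ and $\varepsilon>0$ there is $\delta>0$ such that for every $y\in X$ with $d(x,y)<\delta$ we have $\limsup_{N-M\to\infty}\frac1{N-M}\sum_{i=M}^{N-1}d(T^ix,T^iy)<\varepsilon$, where $\limsup_{N-M\to\infty}\frac1{N-M}\sum_{i=M}^{N-1}a_i:=\limsup_{n\to\infty}\sup_{N-M=n}\frac1n\sum_{i=M}^{N-1}a_i$ (with $M\ge0$). A t.d.s. is mean sensitive if there is $\delta>0$ such that for every non-empty open set $U$ of the phase space there are $x,y\in U$ with $\limsup_{n\to\infty}\frac1n\sum_{i=0}^{n-1}d(T^ix,T^iy)>\delta$ (for $(K(X),T_K)$, use $d_H$ and $T_K$).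 *)

(* Defs.v *)
From HB Require Import structures.
From mathcomp Require Import all_boot all_order all_algebra finmap.
From mathcomp Require Import all_classical all_reals all_analysis.

Set Implicit Arguments.
Unset Strict Implicit.
Unset Printing Implicit Defensive.

Import Order.TTheory GRing.Theory Num.Theory.
Import numFieldNormedType.Exports.

Local Open Scope classical_set_scope.
Local Open Scope ring_scope.

Record tds (R : realType) := Tds {
  phase :> metricType R;
  tmap : phase -> phase;
  phase_neq0 : [set: phase] !=set0;
  phase_compact : compact [set: phase];
  tmap_continuous : continuous tmap
}.

Arguments tmap {R} t _.
Arguments phase_neq0 {R} t.
Arguments phase_compact {R} t.
Arguments tmap_continuous {R} t.

Section properties.
Context {R : realType}.
Implicit Types S : tds R.

Definition transitive_tds S := forall U V : set S,
  open U -> U !=set0 -> open V -> V !=set0 ->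
  exists2 n, (0 < n)%N & (iter n (tmap S) @` U) `&` V !=set0.

Definition orbit_dist S (x y : S) (i : nat) : R :=
  mdist (iter i (tmap S) x) (iter i (tmap S) y).

(* The averages are bounded by the diameter of the space; they are injected   *)
(* in \bar R only to use its total limsup and supremum.                       *)
Definition mean_dist S (x y : S) : \bar R :=
  limn_esup (fun n => (n%:R^-1 * \sum_(0 <= i < n) orbit_dist x y i)%:E).

Definition Banach_mean_dist S (x y : S) : \bar R :=
  limn_esup (fun n => ereal_sup
    [set (n%:R^-1 * \sum_(M <= i < M + n) orbit_dist x y i)%:E
       | M in [set: nat]]).

Definition Banach_mean_equicontinuous S := forall (x : S) (e : R), 0 < e ->
  exists2 d : R, 0 < d &
    forall y : S, mdist x y < d -> (Banach_mean_dist x y < e%:E)%E.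

Definition mean_sensitive S := exists2 d : R, 0 < d &
  forall U : set S, open U -> U !=set0 ->
    exists x y : S, [/\ U x, U y & (d%:E < mean_dist x y)%E].

Definition separated S (n : nat) (e : R) (A : {fset S}) :=
  forall x y : S, x \in A -> y \in A -> x != y ->
    exists2 i, (i < n)%N & e < orbit_dist x y i.

Definition max_separated S (n : nat) (e : R) : \bar R :=
  ereal_sup [set (#|` A|)%:R%:E | A in [set A : {fset S} | separated n e A]].

(* Bowen's definition. The limsup is nonincreasing in e, so that its limit as *)
(* e tends to 0 is its supremum over e > 0.                                   *)
Definition topological_entropy S : \bar R :=
  ereal_sup [set limn_esup (fun n =>
      ((n%:R^-1)%:E * lne (max_separated S n e))%E)
    | e in [set e : R | 0 < e]].

End properties.

Section hyperspace.
Context {R : realType}.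

Record hyperspace (S : tds R) := Hyperspace {
  hset :> set S;
  hset_neq0 : hset !=set0;
  hset_closed : closed hset
}.

Arguments hset_neq0 {S} h.
Arguments hset_closed {S} h.

HB.instance Definition _ (S : tds R) := gen_eqMixin (hyperspace S).
HB.instance Definition _ (S : tds R) := gen_choiceMixin (hyperspace S).

Variable S : tds R.
Implicit Types A B C : hyperspace S.

Lemma hset_inj A B : hset A = hset B -> A = B.
Proof.
case: A B => [A nA cA] [B nB cB] /= AB; case: _ / AB in nB cB *.
by congr Hyperspace; exact: Prop_irrelevance.
Qed.

(* The max and min of the usual definition are attained by compactness, hence *)
(* equal to the sup and inf below.                                            *)
Definition hausdorff_dist A B : R :=
  Num.max (sup [set inf [set mdist x y | y in hset B] | x in hset A])
          (sup [set inf [set mdist x y | x in hset A] | y in hset B]).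

Lemma mdist_bounded : exists M : R, forall x y : S, mdist x y <= M.
Proof.
have [x0 _] := phase_neq0 S.
have [M MP] : exists M : R, forall x : S, mdist x0 x <= M.
  have /compact_near_coveringP/(_ R +oo (fun M x => mdist x0 x <= M)) cov :=
    phase_compact S.
  have [|M [_ MP]] := cov _; last first.
    by exists (M + 1) => x; apply: MP => //; rewrite ltrDl.
  move=> x _; exists (ball x 1, [set M | mdist x0 x + 1 < M]) => /=.
    split; first exact: nbhsx_ballx.
    by exists (mdist x0 x + 1); split => //; exact: num_real.
  move=> [y M] /= [+ xM]; rewrite ballEmdist /= => xy.
  by rewrite (le_trans (metric_triangle _ x _))// ltW// (lt_trans _ xM)// ltrD2l.
exists (M + M) => x y; rewrite (le_trans (metric_triangle _ x0 _))//.
by rewrite lerD// metric_sym.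
Qed.

Let dinf (x : S) B := inf [set mdist x y | y in hset B].

Let dinf_ge0 x B : 0 <= dinf x B.
Proof.
apply: lb_le_inf; first by have [y By] := hset_neq0 B; exists (mdist x y), y.
by move=> _ [y _ <-]; exact: mdist_ge0.
Qed.

Let dinf_le x B y : hset B y -> dinf x B <= mdist x y.
Proof.
move=> By; apply: ge_inf; last by exists y.
by exists 0 => _ [z _ <-]; exact: mdist_ge0.
Qed.

Let dinf_lt x B e : dinf x B < e -> exists2 y, hset B y & mdist x y < e.
Proof.
move=> /inf_lt[|_ [y By <-] xy]; last by exists y.
by have [y By] := hset_neq0 B; exists (mdist x y), y.
Qed.

Let hausdorff_distE A B : hausdorff_dist A B =
  Num.max (sup [set dinf x B | x in hset A]) (sup [set dinf y A | y in hset B]).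
Proof.
congr (Num.max _ (sup _)); apply: eq_imagel => y _; congr inf.
by apply: eq_imagel => x _; exact: metric_sym.
Qed.

Let sup_dinfP A B : has_ubound [set dinf x B | x in hset A].
Proof.
have [M MP] := mdist_bounded; exists M => _ [x _ <-].
by have [y By] := hset_neq0 B; exact: le_trans (dinf_le _ By) (MP _ _).
Qed.

Lemma hausdorff_dist_sym A B : hausdorff_dist A B = hausdorff_dist B A.
Proof. by rewrite !hausdorff_distE maxC. Qed.

Lemma hausdorff_dist_lt A B e : hausdorff_dist A B < e ->
  forall x, hset A x -> exists2 y, hset B y & mdist x y < e.
Proof.
rewrite hausdorff_distE gt_max => /andP[+ _] x Ax => h.
apply: dinf_lt; apply: le_lt_trans h.
by apply: ub_le_sup; [exact: sup_dinfP|exists x].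
Qed.

Lemma hausdorff_dist_le A B e :
  (forall x, hset A x -> exists2 y, hset B y & mdist x y <= e) ->
  (forall y, hset B y -> exists2 x, hset A x & mdist y x <= e) ->
  hausdorff_dist A B <= e.
Proof.
move=> AB BA; rewrite hausdorff_distE ge_max; apply/andP; split; apply: ge_sup.
- by have [x Ax] := hset_neq0 A; exists (dinf x B), x.
- by move=> _ [x /AB[y By xy] <-]; exact: le_trans (dinf_le _ By) xy.
- by have [x Ax] := hset_neq0 B; exists (dinf x A), x.
- by move=> _ [x /BA[y By xy] <-]; exact: le_trans (dinf_le _ By) xy.
Qed.

Lemma hausdorff_dist_ge0 A B : 0 <= hausdorff_dist A B.
Proof.
have [x Ax] := hset_neq0 A; rewrite hausdorff_distE le_max.
apply/orP; left; apply: le_trans (dinf_ge0 x B) _.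
by apply: ub_le_sup; [exact: sup_dinfP|exists x].
Qed.

Lemma hausdorff_distxx A : hausdorff_dist A A = 0.
Proof.
apply/eqP; rewrite eq_le hausdorff_dist_ge0 andbT.
by apply: hausdorff_dist_le => x Ax; exists x; rewrite ?mdistxx.
Qed.

Lemma hausdorff_dist_eq0 A B : hausdorff_dist A B = 0 -> A = B.
Proof.
suff sub C D : hausdorff_dist C D = 0 -> hset C `<=` hset D.
  move=> AB0; apply: hset_inj; apply/seteqP; split; apply: sub => //.
  by rewrite hausdorff_dist_sym.
move=> CD0 x Cx; apply: hset_closed => U /nbhs_ballP[e /= e0 xU].
have [|y Dy xy] := @hausdorff_dist_lt C D e _ x Cx; first by rewrite CD0.
by exists y; split => //; apply: xU; rewrite ballEmdist.
Qed.

Lemma hausdorff_dist_triangle B A C :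
  hausdorff_dist A C <= hausdorff_dist A B + hausdorff_dist B C.
Proof.
apply/ler_addgt0Pl => e e0.
suff half (A' B' C' : hyperspace S) x : hset A' x -> exists2 y, hset C' y &
    mdist x y <= e + (hausdorff_dist A' B' + hausdorff_dist B' C').
  apply: hausdorff_dist_le => x; first exact: half.
  rewrite (hausdorff_dist_sym A) (hausdorff_dist_sym B C).
  by rewrite [X in e + X]addrC; exact: half.
move=> Ax.
have e2 : 0 < e / 2 by rewrite divr_gt0.
have [|y By xy] := @hausdorff_dist_lt A' B' (hausdorff_dist A' B' + e / 2) _ _ Ax.
  by rewrite ltrDl.
have [|z Cz yz] := @hausdorff_dist_lt B' C' (hausdorff_dist B' C' + e / 2) _ _ By.
  by rewrite ltrDl.
exists z => //; apply: le_trans (metric_triangle _ y _) _.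
by rewrite (le_trans (ltW (ltrD xy yz)))// addrACA -splitr addrC.
Qed.

HB.instance Definition _ := isMetric.Build R (hyperspace S)
  hausdorff_distxx hausdorff_dist_eq0 hausdorff_dist_sym hausdorff_dist_triangle.

Lemma hyperspace_neq0 : [set: hyperspace S] !=set0.
Proof.
by exists (Hyperspace (phase_neq0 S) closedT).
Qed.

Let ultra_lim (F : set_system (hyperspace S)) (g : hyperspace S -> S) :
  UltraFilter F -> exists x : S, g @ F --> x.
Proof.
move=> FU.
have gU : UltraFilter (g @ F).
  split; first exact: fmap_proper_filter.
  move=> G PG FG; apply/seteqP; split => // U GU.
  have [//|nU] := in_ultra_setVsetC (g @^-1` U) FU.
  have : G (~` U) by apply: FG.
  by move=> /(filterI GU); rewrite setICr => /filter_not_empty.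
have := phase_compact S; rewrite compact_ultra.
by move=> /(_ _ gU filterT)[x [_ gx]]; exists x.
Qed.

Lemma hyperspace_compact : compact [set: hyperspace S].
Proof.
rewrite compact_ultra => F FU _.
have PF : ProperFilter F by exact: ultra_proper.
pose L : set S := [set x | forall e, 0 < e ->
  F [set C | exists2 y, hset C y & mdist x y < e]].
have limL (g : hyperspace S -> S) x (P : set (hyperspace S)) : F P ->
    (forall C, P C -> hset C (g C)) -> g @ F --> x -> L x.
  move=> FP Pg gx e e0.
  have xg : F [set C | mdist x (g C) < e].
    exact: metricType_numDomainType.cvgr_dist_lt.
  by apply: filterS (filterI FP xg) => C [/Pg gC {}xg]; exists (g C).
have pt C : exists x, hset C x by have [x] := hset_neq0 C; exists x.
have [g0 g0P] := choice pt.
have L0 : L !=set0.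
  have [x gx] := ultra_lim g0 FU.
  by exists x; apply: (limL g0 x setT) => //; exact: filterT.
have Lc : closed L.
  move=> x xL e e0; have e2 : 0 < e / 2 by rewrite divr_gt0.
  have [y [Ly]] := xL _ (nbhsx_ballx x _ e2); rewrite ballEmdist /= => xy.
  apply: filterS (Ly _ e2) => C [z Cz yz]; exists z => //.
  by rewrite (le_lt_trans (metric_triangle _ y _))// [e]splitr ltrD.
exists (Hyperspace L0 Lc); split=> //.
apply/metricType_numDomainType.fcvgrPdist_lt => e e0.
have e2 : 0 < e / 2 by rewrite divr_gt0.
have [e4 e42] : 0 < e / 2 / 2 /\ e / 2 / 2 + e / 2 / 2 = e / 2.
  by rewrite -splitr divr_gt0.
suff [F1 F2] : F [set C | forall x, L x -> exists2 y, hset C y & mdist x y <= e / 2]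
    /\ F [set C | forall y, hset C y -> exists2 x, L x & mdist y x <= e / 2].
  apply: filterS2 F1 F2 => C C1 C2; rewrite (@le_lt_trans _ _ (e / 2))//.
    exact: hausdorff_dist_le.
  by rewrite ltr_pdivrMr// ltr_pMr// ltr1n.
split.
- have [//|nF] := in_ultra_setVsetC [set C : hyperspace S | forall x, L x ->
      exists2 y, hset C y & mdist x y <= e / 2] FU.
  have /choice[g gP] (C : hyperspace S) : exists x,
      ~ (forall x, L x -> exists2 y, hset C y & mdist x y <= e / 2) ->
      L x /\ forall y, hset C y -> e / 2 < mdist x y.
    have [h|/existsNP[x /not_implyP[Lx h]]] := pselect (forall x, L x ->
      exists2 y, hset C y & mdist x y <= e / 2); first by have [x] := L0; exists x.
    exists x => _; split => // y Cy; rewrite ltNge; apply/negP => xy.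
    by apply: h; exists y.
  have [x gx] := ultra_lim g FU.
  have nearx d : 0 < d -> F [set C | mdist x (g C) < d].
    exact: metricType_numDomainType.cvgr_dist_lt.
  have Lx : L x.
    apply: Lc => U /nbhs_ballP[d /= d0 xU].
    have [C [/gP[Lg _] xg]] := filter_ex (filterI nF (nearx _ d0)).
    by exists (g C); split => //; apply: xU; rewrite ballEmdist.
  have [C [/gP[_ gC] [xg [y Cy xy]]]] :=
    filter_ex (filterI nF (filterI (nearx _ e4) (Lx _ e4))).
  have := gC _ Cy; rewrite ltNge => /negP[].
  rewrite (le_trans (metric_triangle _ x _))// -e42 metric_sym.
  by rewrite ltW// ltrD.
- have [//|nF] := in_ultra_setVsetC [set C : hyperspace S | forall y, hset C y ->
      exists2 x, L x & mdist y x <= e / 2] FU.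
  have /choice[g gP] (C : hyperspace S) : exists y,
      ~ (forall y, hset C y -> exists2 x, L x & mdist y x <= e / 2) ->
      hset C y /\ forall x, L x -> e / 2 < mdist y x.
    have [h|/existsNP[x /not_implyP[Lx h]]] := pselect (forall y, hset C y ->
      exists2 x, L x & mdist y x <= e / 2); first by have [x] := L0; exists x.
    exists x => _; split => // y Cy; rewrite ltNge; apply/negP => xy.
    by apply: h; exists y.
  have [x gx] := ultra_lim g FU.
  have Lx : L x by apply: (limL g x _ nF) => // C /gP[].
  have xg : F [set C | mdist x (g C) < e / 2].
    exact: metricType_numDomainType.cvgr_dist_lt.
  have [C [/gP[_ gC] {}xg]] := filter_ex (filterI nF xg).
  by have := gC _ Lx; rewrite ltNge metric_sym ltW.
Qed.

Lemma himage_neq0 C : tmap S @` hset C !=set0.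
Proof. by have [x Cx] := hset_neq0 C; exists (tmap S x), x. Qed.

Lemma himage_closed C : closed (tmap S @` hset C).
Proof.
apply: compact_closed; first exact: metric_hausdorff.
apply: continuous_compact.
  exact/continuous_subspaceT/(tmap_continuous S).
exact: (subclosed_compact (hset_closed C) (phase_compact S)).
Qed.

Definition himage C : hyperspace S := Hyperspace (himage_neq0 C) (@himage_closed C).

Lemma tmap_unif_continuous e : 0 < e -> exists2 d, 0 < d &
  forall x y : S, mdist x y < d -> mdist (tmap S x) (tmap S y) < e.
Proof.
move=> e0; have e2 : 0 < e / 2 by rewrite divr_gt0.
have /compact_near_coveringP/(_ R 0^'+ (fun d x => forall y, mdist x y < d ->
  mdist (tmap S x) (tmap S y) < e)) cov := phase_compact S.
have [|r /= r0 rP] := cov _; last first.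
  have r2 : 0 < r / 2 by rewrite divr_gt0.
  exists (r / 2) => // x y xy; apply: (rP (r / 2)) xy => //=.
  rewrite sub0r normrN gtr0_norm//.
  by rewrite ltr_pdivrMr// ltr_pMr// ltr1n.
move=> x _.
have : \forall y \near x, mdist (tmap S x) (tmap S y) < e / 2.
  have /metricType_numDomainType.cvgrPdist_lt := tmap_continuous S x.
  exact.
move=> /nbhs_ballP[r /= r0 xr]; have r2 : 0 < r / 2 by rewrite divr_gt0.
exists (ball x (r / 2), [set d | d < r / 2]) => /=.
  split; first exact: nbhsx_ballx.
  exact: nbhs_right_lt.
move=> [x' d] /= [+ dr] y x'y; rewrite ballEmdist /= => xx'.
have hx' : mdist (tmap S x) (tmap S x') < e / 2.
  apply: xr; rewrite ballEmdist /= (lt_trans xx')//.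
  by rewrite ltr_pdivrMr// ltr_pMr// ltr1n.
have hy : mdist (tmap S x) (tmap S y) < e / 2.
  apply: xr; rewrite ballEmdist /= (le_lt_trans (metric_triangle _ x' _))//.
  by rewrite [r]splitr ltrD// (lt_trans x'y).
rewrite (le_lt_trans (metric_triangle _ (tmap S x) _))//.
by rewrite metric_sym [e]splitr ltrD.
Qed.

Lemma himage_continuous : continuous himage.
Proof.
move=> C; apply/(@metricType_numDomainType.cvgrPdist_le _ _ _ _ (nbhs_filter C)) => e e0.
have [d d0 dP] := tmap_unif_continuous e0.
apply/nbhs_ballP; exists d => //= D; rewrite ballEmdist /= => CD.
apply: hausdorff_dist_le => _ [x Cx <-].
- have [y Dy xy] := hausdorff_dist_lt CD Cx.
  by exists (tmap S y); [exists y|rewrite ltW// dP].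
- move: CD; rewrite /mdist /= hausdorff_dist_sym => /hausdorff_dist_lt/(_ _ Cx).
  by move=> [y Dy xy]; exists (tmap S y); [exists y|rewrite ltW// dP].
Qed.

(* The induced system (K(X), T_K). *)
Definition hyper_tds : tds R :=
  Tds hyperspace_neq0 hyperspace_compact himage_continuous.

End hyperspace.

(* Main.v *)
From HB Require Import structures.
Require Import Defs.
From mathcomp Require Import all_boot all_order all_algebra finmap.
From mathcomp Require Import zify lra.
From mathcomp Require Import all_classical all_reals all_analysis.

Set Implicit Arguments.
Unset Strict Implicit.
Unset Printing Implicit Defensive.

Import Order.TTheory GRing.Theory Num.Theory.
Import numFieldNormedType.Exports.

Local Open Scope classical_set_scope.
Local Open Scope ring_scope.

(** The example is the one-sided subshift X of the 0-1 sequences in which any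
    window of length n contains at most the square root of n ones.

    Since the square root is o(n), the ones have density zero in every element
    of X, uniformly in the position of the window, and so the Banach mean
    distance of any two points vanishes ([Banach_mean_dist_le]): X is Banach-mean
    equicontinuous and not mean sensitive. It has zero entropy because there are
    only subexponentially many words of length n with at most the square root of
    n ones ([card_small_sets]). It is transitive because the square root is
    unbounded: two words of X may follow each other after a long enough run of
    zeros ([sparse_glue]).

    A closed set, on the other hand, can have at every time an element with a one
    at that time, each element having only few ones. The sets of the sequences
    whose ones lie in a given set P of positions distinguish all the subsets P
    of {0, .., n - 1} in n steps, so that the entropy of the hyperspace is at
    least ln 2 ([hyper_entropy_gt0]). Likewise, any closed set C can be
    approximated by a set of eventually vanishing sequences, and by a set which,
    for each large i, has an element with a one at coordinate i, obtained by
    gluing a late isolated one to a word of C; the orbits of these two sets stay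
    at distance 1 ([hyper_mean_sensitive]). *)

(** * Sparse sequences *)

(** Any nondecreasing unbounded function of the length of the window, at least 1
    on the positive lengths and negligible with respect to the length, could
    replace the square root. *)
Definition sparse (x : nat -> bool) := forall m n,
  ((\sum_(m <= i < n) x i) ^ 2 <= n - m)%N.

Lemma sparse_sub (x y : nat -> bool) :
  (forall i, y i -> x i) -> sparse x -> sparse y.
Proof.
move=> yx xs m n; apply: leq_trans (xs m n); rewrite leq_sqr.
by apply: leq_sum => i _; have := yx i; case: (y i) => // ->.
Qed.

Lemma sum_delay s (x : nat -> bool) m n :
  (\sum_(m <= i < n) ((s <= i) && x (i - s)) = \sum_(m - s <= i < n - s) x i)%N.
Proof.
transitivity (\sum_(m - s <= i < n - s) x (i + s - s))%N; last first.
  by apply: eq_bigr => i _; rewrite addnK.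
rewrite -(big_addn _ _ _ xpredT (fun i => nat_of_bool (x (i - s)%N))).
rewrite (big_nat_widenl (m - s + s) m) ?[RHS]big_mkcond /=; last by lia.
apply: eq_big_nat => i /andP[mi _].
have -> : (m - s + s <= i)%N = (s <= i)%N by apply/idP/idP; lia.
by case: (s <= i)%N.
Qed.

Lemma sparse_delay s (x : nat -> bool) :
  sparse x -> sparse (fun i => (s <= i)%N && x (i - s)%N).
Proof.
by move=> xs m n; rewrite sum_delay; apply: leq_trans (xs _ _) _; lia.
Qed.

Lemma sum_window_le p N m n : (\sum_(m <= i < n) (p <= i < p + N) <= N)%N.
Proof.
suff : (\sum_(m <= i < n) (p <= i < p + N) <= minn n (p + N) - p)%N by lia.
elim: n => [|n IH]; first by rewrite big_geq.
have [mn|nm] := leqP m n; last by rewrite big_geq.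
by rewrite big_nat_recr //=; case: (boolP (p <= n < p + N)%N) => /=; lia.
Qed.

Definition glue_bits (x y : nat -> bool) N s i :=
  (i < N)%N && x i || [&& (s <= i)%N, (i < s + N)%N & y (i - s)%N].

(** A window that meets both blocks contains the gap between them, which is long
    enough for the at most N + N ones of the two blocks; any other window sees
    the ones of a window of x or of y only. *)
Lemma sparse_glue x y N s : sparse x -> sparse y ->
  (N + (N + N) ^ 2 <= s)%N -> sparse (glue_bits x y N s).
Proof.
move=> xs ys Ns m n.
pose a i := (i < N)%N && x i.
pose b i := [&& (s <= i)%N, (i < s + N)%N & y (i - s)%N].
have as_ : sparse a by apply: sparse_sub xs => i /andP[].
have bs : sparse b.
  by apply: sparse_sub (sparse_delay s ys) => i /and3P[-> _ ->].
have ab : (\sum_(m <= i < n) glue_bits x y N s i <=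
    \sum_(m <= i < n) a i + \sum_(m <= i < n) b i)%N.
  rewrite -big_split; apply: leq_sum => i _.
  by rewrite /glue_bits -/(a i) -/(b i); case: (a i); case: (b i).
have [mN|Nm] := ltnP m N; last first.
  have a0 : (\sum_(m <= i < n) a i = 0)%N.
    rewrite big_nat_cond big1// => i /andP[/andP[mi _] _].
    by rewrite /a ltnNge (leq_trans Nm mi).
  by apply: leq_trans (bs m n); rewrite leq_sqr; rewrite a0 in ab.
have [sn|ns] := ltnP s n; last first.
  have b0 : (\sum_(m <= i < n) b i = 0)%N.
    rewrite big_nat_cond big1// => i /andP[/andP[_ i_n] _].
    by rewrite /b leqNgt (leq_trans i_n ns).
  by apply: leq_trans (as_ m n); rewrite leq_sqr; rewrite b0 addn0 in ab.
apply: (@leq_trans ((N + N) ^ 2)%N); last by lia.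
rewrite leq_sqr; apply: leq_trans ab _; apply: leq_add.
- apply: leq_trans (sum_window_le 0 N m n); apply: leq_sum => i _.
  by rewrite /a add0n; case: ltnP => //= _; exact: leq_b1.
- apply: leq_trans (sum_window_le s N m n); apply: leq_sum => i _.
  by rewrite /b andbA; case: (s <= i < s + N)%N => //=; exact: leq_b1.
Qed.

Lemma sparse0 : sparse (fun=> false).
Proof. by move=> m n; rewrite big1. Qed.

Lemma sparse_single k : sparse (fun i => i == k).
Proof.
move=> m n; have [mn|nm] := ltnP m n; last by rewrite big_geq.
have h : (\sum_(m <= i < n) (i == k) <= 1)%N.
  apply: leq_trans (sum_window_le k 1 m n).
  by apply: leq_sum => i _; apply: eq_leq; congr nat_of_bool; lia.
by apply: (@leq_trans (1 ^ 2)%N); [rewrite leq_sqr|lia].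
Qed.

Section sequence_space.
Variable R : realType.

(** * The metric space of sparse sequences *)

(** [K] is the field in which the metric takes its values: its presence in the
    type lets the metric structure be inferred from the type. *)
Record sparse_seq (K : realType) :=
  SparseSeq { bits :> nat -> bool; bits_sparse : sparse bits }.

HB.instance Definition _ := gen_eqMixin (sparse_seq R).
HB.instance Definition _ := gen_choiceMixin (sparse_seq R).

Local Notation X := (sparse_seq R).
Implicit Types x y z : X.

Lemma bits_inj x y : bits x =1 bits y -> x = y.
Proof.
case: x y => [x xs] [y ys] /= /funext xy; case: _ / xy in ys *.
by congr SparseSeq; exact: Prop_irrelevance.
Qed.

Definition agree N x y := forall i, (i < N)%N -> x i = y i.

Definition seq_dist x y : R :=
  if pselect (exists n, x n != y n) is left h then (ex_minn h).+1%:R^-1 else 0.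

Lemma seq_dist_le N x y : agree N x y -> seq_dist x y <= N.+1%:R^-1.
Proof.
move=> xy; rewrite /seq_dist; case: pselect => [h|_]; last by rewrite invr_ge0.
case: ex_minnP => n xyn _; rewrite lef_pV2 ?posrE// ler_nat ltnS leqNgt.
by apply: contra xyn => /xy ->.
Qed.

Lemma seq_dist_ge n x y : x n != y n -> n.+1%:R^-1 <= seq_dist x y.
Proof.
move=> xyn; rewrite /seq_dist; case: pselect => [h|[]]; last by exists n.
by case: ex_minnP => k _ /(_ _ xyn) kn; rewrite lef_pV2 ?posrE// ler_nat.
Qed.

Lemma seq_dist_lt_agree N x y : seq_dist x y < N.+1%:R^-1 -> agree N.+1 x y.
Proof.
move=> xy i iN; apply/eqP; apply: contraLR xy => /seq_dist_ge xy.
by rewrite -leNgt (le_trans _ xy)// lef_pV2 ?posrE// ler_nat.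
Qed.

Lemma seq_distxx x : seq_dist x x = 0.
Proof.
rewrite /seq_dist; case: pselect => // e.
by exfalso; case: e => n; rewrite eqxx.
Qed.

Lemma seq_dist_eq0 x y : seq_dist x y = 0 -> x = y.
Proof.
move=> xy0; apply: bits_inj => n; apply/eqP; apply: contra_eqT xy0.
by move=> /seq_dist_ge; apply: contraTneq => ->; rewrite -ltNge invr_gt0.
Qed.

Lemma seq_dist_sym x y : seq_dist x y = seq_dist y x.
Proof.
suff h u v : seq_dist u v <= seq_dist v u by apply/eqP; rewrite eq_le !h.
rewrite {1}/seq_dist; case: pselect => [e|_]; last first.
  by rewrite /seq_dist; case: pselect => // e; rewrite invr_ge0.
by case: ex_minnP => n uvn _; apply: seq_dist_ge; rewrite eq_sym.
Qed.

Lemma seq_dist_ge0 x y : 0 <= seq_dist x y.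
Proof. by rewrite /seq_dist; case: pselect => // e; rewrite invr_ge0. Qed.

Lemma seq_dist_triangle y x z : seq_dist x z <= seq_dist x y + seq_dist y z.
Proof.
rewrite {1}/seq_dist; case: pselect => [e|_]; last first.
  by rewrite addr_ge0// seq_dist_ge0.
case: ex_minnP => n xzn _; have [xy|xyn] := eqVneq (x n) (y n).
- rewrite xy in xzn.
  by rewrite (le_trans (seq_dist_ge xzn))// lerDr seq_dist_ge0.
- by rewrite (le_trans (seq_dist_ge xyn))// lerDl seq_dist_ge0.
Qed.

HB.instance Definition _ := isMetric.Build R (sparse_seq R)
  seq_distxx seq_dist_eq0 seq_dist_sym seq_dist_triangle.

Lemma exists_natSinv_lt (e : R) : 0 < e -> exists N : nat, N.+1%:R^-1 < e.
Proof.
move=> e0; have [N _ /(_ N (leqnn N)) h] := near_infty_natSinv_lt (PosNum e0).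
by exists N.
Qed.

Lemma nbhs_agree (x : X) (U : set X) :
  nbhs x U -> exists N, forall y, agree N x y -> U y.
Proof.
move=> /nbhs_ballP[e /= e0 eU]; have [N Ne] := exists_natSinv_lt e0.
exists N => y xy; apply: eU; rewrite ballEmdist /=.
exact: le_lt_trans (seq_dist_le xy) Ne.
Qed.

Lemma closed_agree (D : set X) :
  (forall y, (forall N, exists2 z, D z & agree N y z) -> D y) -> closed D.
Proof.
move=> h y yD; apply: h => N.
have N0 : (0 : R) < N.+1%:R^-1 by rewrite invr_gt0.
have [z [Dz]] := yD _ (nbhsx_ballx y _ N0).
rewrite ballEmdist /= => /seq_dist_lt_agree yz.
by exists z => // i iN; rewrite yz// ltnW.
Qed.

(** An ultrafilter decides the value of every coordinate; the sequence of the
    decided values is its limit, and is sparse because each condition defining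
    sparseness involves finitely many coordinates. *)
Lemma sparse_seq_compact : compact [set: X].
Proof.
rewrite compact_ultra => F FU _; have PF : ProperFilter F by exact: ultra_proper.
pose l i := `[< F [set y : X | y i] >].
have Fl i : F [set y : X | y i = l i].
  rewrite /l; case: asboolP => // nF.
  have [//|] := in_ultra_setVsetC [set y : X | y i] FU.
  by apply: filterS => y /= /negP/negbTE.
have FN N : F [set y : X | forall i, (i < N)%N -> y i = l i].
  elim: N => [|N IH]; first by apply: filterS filterT => y _ i.
  apply: filterS2 IH (Fl N) => y yl yN i; rewrite ltnS leq_eqVlt.
  by move=> /predU1P[->//|]; exact: yl.
have ls : sparse l.
  move=> m n; have [y yl] := filter_ex (FN n).
  rewrite -(eq_big_nat _ _ (F1 := fun i => nat_of_bool (y i))).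
    exact: bits_sparse.
  by move=> i /andP[_ /yl ->].
exists (SparseSeq R ls); split => //.
apply/metricType_numDomainType.fcvgrPdist_lt => e e0.
have [N Ne] := exists_natSinv_lt e0.
apply: filterS (FN N) => y yl; apply: le_lt_trans Ne; apply: seq_dist_le.
by move=> i /yl /= ->.
Qed.

(** * The shift *)

Lemma seq_shift_sparse x : sparse (fun i => x i.+1).
Proof.
by move=> m n; have := bits_sparse x m.+1 n.+1; rewrite big_add1 subSS.
Qed.

Definition seq_shift x : X := SparseSeq R (seq_shift_sparse x).

Lemma iter_seq_shiftE n x i : iter n seq_shift x i = x (n + i)%N.
Proof. by elim: n i => //= n IH i; rewrite IH addnS. Qed.

Lemma seq_shift_continuous : continuous seq_shift.
Proof.
move=> x; apply/(@metricType_numDomainType.cvgrPdist_lt _ _ _ _ (nbhs_filter x)).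
move=> e e0; have [N Ne] := exists_natSinv_lt e0.
have N0 : (0 : R) < N.+1%:R^-1 by rewrite invr_gt0.
apply/nbhs_ballP; exists N.+1%:R^-1 => //= y; rewrite ballEmdist /=.
move=> /seq_dist_lt_agree xy; apply: le_lt_trans Ne; apply: seq_dist_le => i iN.
exact: xy.
Qed.

Lemma sparse_seq_neq0 : [set: X] !=set0.
Proof. by exists (SparseSeq R sparse0). Qed.

Definition sparse_shift : tds R :=
  Tds sparse_seq_neq0 sparse_seq_compact seq_shift_continuous.

End sequence_space.

Section dynamics.
Variable R : realType.
Local Notation X := (sparse_seq R).
Implicit Types x y z : X.

(** * Upper limits of sequences *)

Lemma limn_esup_le (u : nat -> \bar R) c n0 :
  (forall n, (n0 <= n)%N -> (u n <= c)%E) -> (limn_esup u <= c)%E.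
Proof.
move=> uc; rewrite /limn_esup limf_esupE; apply: ge_ereal_inf.
exists (ereal_sup (u @` [set n | (n0 <= n)%N])).
  by exists [set n | (n0 <= n)%N] => //; exact: nbhs_infty_ge.
by apply: ge_ereal_sup => _ [n /= /uc un <-].
Qed.

Lemma limn_esup_ge (u : nat -> \bar R) c n0 :
  (forall n, (n0 <= n)%N -> (c <= u n)%E) -> (c <= limn_esup u)%E.
Proof.
move=> cu; rewrite /limn_esup limf_esupE; apply: le_ereal_inf_tmp.
move=> _ [V [N _ NV] <-]; apply: le_ereal_sup_tmp.
exists (u (maxn n0 N)); last by apply: cu; exact: leq_maxl.
by exists (maxn n0 N) => //; apply: NV => /=; exact: leq_maxr.
Qed.

Lemma le_limn_esup (u v : nat -> \bar R) :
  (forall n, (u n <= v n)%E) -> (limn_esup u <= limn_esup v)%E.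
Proof.
move=> uv; rewrite /limn_esup !limf_esupE; apply: le_ereal_inf_tmp.
move=> _ [V NV <-]; apply: ge_ereal_inf; exists (ereal_sup (u @` V)).
  by exists V.
apply: ge_ereal_sup => _ [n Vn <-]; apply: le_ereal_sup_tmp.
by exists (v n); [exists n|exact: uv].
Qed.

(** * Density zero of the ones *)

Lemma le_mul_of_sq_le (c N : nat) (e : R) : 0 < e ->
  (c ^ 2 <= N)%N -> (e ^+ 2)^-1 <= N%:R -> c%:R <= e * N%:R.
Proof.
move=> e0 cN eN; rewrite -ler_sqr ?nnegrE ?mulr_ge0 ?(ltW e0)//.
rewrite -natrX (@le_trans _ _ N%:R)// ?ler_nat//.
rewrite exprMn [N%:R ^+ 2]expr2 mulrA -[X in X <= _]mul1r ler_wpM2r//.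
by rewrite -ler_pdivrMl ?mulr1// exprn_gt0.
Qed.

Lemma nat_bound (r : R) : exists n0 : nat, forall n, (n0 <= n)%N -> r <= n%:R.
Proof.
exists (Num.truncn r).+1 => n h; apply: ltW.
by apply: lt_le_trans (truncnS_gt r) _; rewrite ler_nat.
Qed.

Lemma sparse_window (x : nat -> bool) M n j : sparse x ->
  ((\sum_(M <= i < M + n) x (i + j)) ^ 2 <= n)%N.
Proof.
move=> xs; have := xs (M + j)%N (M + n + j)%N.
by rewrite big_addn addnK; congr (_ <= _)%N; lia.
Qed.

Lemma orbit_dist_le k (x y : sparse_shift R) i : orbit_dist x y i <=
  k.+1%:R^-1 + \sum_(j < k) ((x (i + j)%N)%:R + (y (i + j)%N)%:R).
Proof.
set s := (X in _ + X).
have s0 : 0 <= s by apply: sumr_ge0 => j _; rewrite addr_ge0.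
have k0 : 0 <= k.+1%:R^-1 :> R by rewrite invr_ge0.
have [xy|] :=
  pselect (agree k (iter i (@seq_shift R) x) (iter i (@seq_shift R) y)).
  by rewrite (le_trans (seq_dist_le xy))// lerDl.
move=> /existsNP[j /not_implyP[jk]]; rewrite !iter_seq_shiftE => xyj.
have s1 : 1 <= s.
  rewrite /s (bigD1 (Ordinal jk))//=.
  rewrite -[1]addr0 lerD//; last by apply: sumr_ge0 => ? _; rewrite addr_ge0.
  move: xyj; case: (x (i + j)%N); case: (y (i + j)%N);
    by rewrite //= ?addr0 ?add0r.
apply: le_trans (le_trans s1 _); last by rewrite lerDr.
by apply: le_trans (@seq_dist_le _ 0 _ _ _) _ => //; rewrite invr1.
Qed.

(** Two points are far apart at time i only if one of them has a one among its
    coordinates i, .., i + k - 1, so that the density of ones bounds the mean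
    distance, uniformly in the position of the window. *)
Lemma Banach_mean_dist_le (x y : sparse_shift R) (e : R) : 0 < e ->
  (Banach_mean_dist x y <= e%:E)%E.
Proof.
move=> e0; have [k ke] : exists k : nat, k.+1%:R^-1 < e / 2.
  by apply: exists_natSinv_lt; rewrite divr_gt0.
(* Each of the 2 * k coordinate sums below contributes at most h to the mean. *)
pose h : R := e / 4 / k.+1%:R.
have h0 : 0 < h by rewrite !divr_gt0.
have [n0 n0P] := nat_bound ((h ^+ 2)^-1).
apply: (@limn_esup_le _ _ n0.+1) => n n0n.
have n_gt0 : 0 < n%:R :> R by rewrite ltr0n (leq_trans _ n0n).
apply: ge_ereal_sup => _ [M _ <-]; rewrite lee_fin mulrC ler_pdivrMr//.
have win z j : \sum_(M <= i < M + n) (z (i + j)%N)%:R <= h * n%:R.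
  rewrite -natr_sum; apply: le_mul_of_sq_le => //.
    exact/sparse_window/bits_sparse.
  by apply: n0P; rewrite ltnW.
apply: le_trans (_ : \sum_(M <= i < M + n) (k.+1%:R^-1 +
   \sum_(j < k) ((x (i + j)%N)%:R + (y (i + j)%N)%:R)) <= _).
  by apply: ler_sum => i _; exact: orbit_dist_le.
rewrite big_split /= big_const_nat addKn iter_addr_0 exchange_big /=.
apply: le_trans (_ : e / 2 * n%:R + \sum_(j < k) (2 * (h * n%:R)) <= _).
  apply: lerD.
    by rewrite -[X in X <= _]mulr_natr ler_wpM2r ?ler0n// ltW.
  apply: ler_sum => j _; rewrite big_split /= mulr_natl mulr2n.
  by apply: lerD; exact: win.
rewrite sumr_const card_ord -[(2 * _) *+ k]mulr_natr.
have hk : h * k%:R <= e / 4.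
  rewrite /h -mulrA ler_piMr ?divr_ge0 ?(ltW e0)//.
  by rewrite mulrC ler_pdivrMr// mul1r ler_nat.
nra.
Qed.

Lemma mean_dist_le_Banach (S : tds R) (x y : S) :
  (mean_dist x y <= Banach_mean_dist x y)%E.
Proof.
apply: le_limn_esup => n; apply: ereal_sup_ubound.
by exists 0%N => //; rewrite add0n.
Qed.

Lemma sparse_shift_equicontinuous : Banach_mean_equicontinuous (sparse_shift R).
Proof.
move=> x e e0; exists 1 => // y _.
have e2 : 0 < e / 2 by rewrite divr_gt0.
by apply: le_lt_trans (Banach_mean_dist_le x y e2) _; rewrite lte_fin; lra.
Qed.

Lemma sparse_shift_not_sensitive : ~ mean_sensitive (sparse_shift R).
Proof.
move=> [d d0 /(_ setT openT (sparse_seq_neq0 R))[x [y [_ _]]]].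
rewrite ltNge => /negP[]; apply: le_trans (mean_dist_le_Banach x y) _.
exact: Banach_mean_dist_le.
Qed.

(** * Transitivity *)

Definition glue_seq x y N s (h : (N + (N + N) ^ 2 <= s)%N) : X :=
  SparseSeq R (sparse_glue (bits_sparse x) (bits_sparse y) h).

Lemma sparse_shift_transitive : transitive_tds (sparse_shift R).
Proof.
move=> U V oU [x Ux] oV [y Vy].
have [N1 N1U] := nbhs_agree (open_nbhs_nbhs (conj oU Ux)).
have [N2 N2V] := nbhs_agree (open_nbhs_nbhs (conj oV Vy)).
(* The successor makes the return time s positive. *)
pose N := (N1 + N2)%N; pose s := (N + (N + N) ^ 2).+1%N.
pose z := glue_seq x y (leqnSn _ : (N + (N + N) ^ 2 <= s)%N).
exists s => //; exists (iter s (@seq_shift R) z); split.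
- exists z => //; apply: N1U => i iN1; rewrite /z /= /glue_bits.
  have -> : (i < N)%N by rewrite /N; lia.
  have -> : (s <= i)%N = false by rewrite /s /N; lia.
  by rewrite orbF.
- apply: N2V => i iN2; rewrite iter_seq_shiftE /z /= /glue_bits addKn.
  have -> : (s + i < N)%N = false by rewrite /s; lia.
  by rewrite leq_addr ltn_add2l (leq_trans iN2)// leq_addl.
Qed.

(** * Zero entropy *)

Lemma sum_expr_card (N : nat) (t : R) :
  \sum_(s : {set 'I_N}) t ^+ #|s| = (t + 1) ^+ N.
Proof.
rewrite -[in RHS](card_ord N) -prodr_const bigA_distr; apply: eq_bigr => s _.
by rewrite -big_mkcond prodr_const.
Qed.

(** If a subset with c elements is given the weight t ^+ c, then the total weight
    of the subsets is (1 + t) ^+ N, which is at most expR (t * N). As t^-1 is at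
    most expR t^-1, the weight t ^+ c is at least expR (- (c / t)), hence at
    least expR (- (t * N)) when c is at most t ^+ 2 * N, which holds for all the
    subsets under consideration once N is large. *)
Lemma card_small_sets (N : nat) (t : R) : 0 < t ->
  ((t ^+ 2) ^+ 2)^-1 <= N%:R ->
  #|[pred s : {set 'I_N} | (#|s| ^ 2 <= N)%N]|%:R <= expR (2 * t * N%:R).
Proof.
move=> t0 tN; have t20 : 0 < t ^+ 2 by rewrite exprn_gt0.
rewrite -sum1_card natr_sum.
apply: (@le_trans _ _ (\sum_(s : {set 'I_N}) expR (t * N%:R) * t ^+ #|s|)).
  rewrite big_mkcond /=; apply: ler_sum => s _.
  have w0 : 0 <= expR (t * N%:R) * t ^+ #|s|.
    by rewrite mulr_ge0 ?expR_ge0// exprn_ge0// ltW.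
  rewrite unfold_in /=; case: ifPn => // sN.
  have cN := le_mul_of_sq_le t20 sN tN.
  apply: (@le_trans _ _ (expR t^-1 ^+ #|s| * t ^+ #|s|)).
    rewrite -exprMn exprn_ege1// -[X in X <= _](mulVf (lt0r_neq0 t0)).
    rewrite ler_wpM2r ?(ltW t0)//.
    by apply: le_trans (expR_ge1Dx _); rewrite lerDr.
  rewrite ler_wpM2r ?exprn_ge0 ?(ltW t0)// -expRM_natl ler_expR.
  by rewrite ler_pdivrMr// (le_trans cN)// expr2; lra.
rewrite -mulr_sumr sum_expr_card -mulrA mulr_natl mulr2n expRD.
rewrite ler_wpM2l ?expR_ge0//.
rewrite mulrC expRM_natl lerXn2r ?nnegrE ?expR_ge0 ?addr_ge0 ?(ltW t0)//.
by rewrite addrC expR_ge1Dx.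
Qed.

Lemma card_separated (n k : nat) (e : R) (A : {fset sparse_shift R}) :
  k.+1%:R^-1 <= e -> Defs.separated n e A ->
  (#|` A| <= #|[pred s : {set 'I_(n + k)} | (#|s| ^ 2 <= n + k)%N]|)%N.
Proof.
move=> ke sA.
pose f (x : sparse_shift R) : {set 'I_(n + k)} :=
  finset (fun i : 'I_(n + k) => x i).
have finj : {in enum_fset A &, injective f}.
  move=> x y xA yA fxy; apply/eqP; apply: contraT => xy.
  have [i i_n] := sA x y xA yA xy; rewrite ltNge => /negP[].
  apply: le_trans ke; apply: seq_dist_le => j jk; rewrite !iter_seq_shiftE.
  have ij : (i + j < n + k)%N by lia.
  by have := congr1 (fun s : {set _} => Ordinal ij \in s) fxy; rewrite !inE.
rewrite -(size_map f) cardE; apply: uniq_leq_size.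
  by rewrite map_inj_in_uniq ?fset_uniq.
move=> _ /mapP[x xA ->]; rewrite mem_enum inE.
have -> : #|f x| = (\sum_(0 <= i < n + k) x i)%N.
  rewrite -sum1_card big_mkcond big_mkord; apply: eq_bigr => i _.
  by rewrite inE; case: (x i).
by have := bits_sparse x 0 (n + k); rewrite subn0.
Qed.

Lemma max_separated_ge1 (S : tds R) n (e : R) : (1 <= max_separated S n e)%E.
Proof.
have [x _] := phase_neq0 S; apply: ereal_sup_ubound.
exists [fset x]%fset; last by rewrite cardfs1.
by move=> y z; rewrite !inE => /eqP -> /eqP ->; rewrite eqxx.
Qed.

Lemma topological_entropy_ge0 (S : tds R) : (0 <= topological_entropy S)%E.
Proof.
apply: le_ereal_sup_tmp; eexists.
  by exists 1 => /=; [exact: ltr01|reflexivity].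
apply: (@limn_esup_ge _ _ 0) => n _.
apply: mule_ge0; rewrite ?lee_fin ?invr_ge0//.
by rewrite lne_ge0 max_separated_ge1.
Qed.

Lemma sparse_shift_entropy0 : topological_entropy (sparse_shift R) = 0%E.
Proof.
apply/eqP; rewrite eq_le topological_entropy_ge0 andbT.
apply: ge_ereal_sup => _ [e /= e0 <-]; apply/lee_addgt0Pr => d d0.
rewrite add0e.
have [k /ltW ke] := exists_natSinv_lt e0.
pose t := d / 4; have t0 : 0 < t by rewrite divr_gt0.
have [n0 n0P] := nat_bound (((t ^+ 2) ^+ 2)^-1).
apply: (@limn_esup_le _ _ (maxn k n0).+1) => n.
rewrite gtn_max => /andP[kn n0n].
have n_gt0 : 0 < n%:R :> R by rewrite ltr0n (leq_ltn_trans _ kn).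
have sep : (max_separated (sparse_shift R) n e <=
    (expR (2 * t * (n + k)%:R))%:E)%E.
  apply: ge_ereal_sup => _ [A /= /(card_separated ke) An <-]; rewrite lee_fin.
  apply: le_trans (card_small_sets t0 (n0P (n + k)%N _)).
    by rewrite ler_nat.
  by lia.
apply: (@le_trans _ _ ((n%:R^-1)%:E * (2 * t * (n + k)%:R)%:E)%E).
  apply: lee_wpmul2l; first by rewrite lee_fin invr_ge0.
  rewrite -[X in (_ <= X%:E)%E]expRK -lne_EFin ?expR_gt0// lee_lne//.
  - by rewrite in_itv /= leey andbT (le_trans _ (max_separated_ge1 _ _ _)).
  - by rewrite in_itv /= leey andbT lee_fin expR_ge0.
rewrite -EFinM lee_fin mulrC ler_pdivrMr// natrD.
have : k%:R <= n%:R :> R by rewrite ler_nat ltnW.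
by rewrite /t; nra.
Qed.

(** * The hyperspace *)

Lemma iter_himageE (S : tds R) n (C : hyperspace S) :
  hset (iter n (@himage R S) C) = iter n (tmap S) @` hset C.
Proof.
elim: n => [|n IH] /=; first by rewrite image_id.
by rewrite IH image_comp.
Qed.

(** What the hyperspace sees and the points do not: at time i, whether a closed
    set has an element with a one at coordinate i. *)
Lemma hyper_orbit_dist_ge1 (A B : hyper_tds (sparse_shift R)) i :
  (exists2 x : X, hset A x & x i) -> (forall y : X, hset B y -> ~~ y i) ->
  1 <= orbit_dist A B i.
Proof.
move=> [x Ax xi] Bi; rewrite leNgt; apply/negP => /hausdorff_dist_lt.
move=> /(_ (iter i (@seq_shift R) x)).
rewrite !iter_himageE => /(_ (imageP _ Ax))[_ [y /Bi yi <-] xy].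
have : agree 1 (iter i (@seq_shift R) x) (iter i (@seq_shift R) y).
  by apply: seq_dist_lt_agree; rewrite invr1.
by move=> /(_ 0 (ltnSn 0)); rewrite !iter_seq_shiftE addn0 xi (negbTE yi).
Qed.

Lemma support_set_subproof (P : nat -> bool) :
  [set y : sparse_shift R | forall i, y i -> P i] !=set0 /\
  closed [set y : sparse_shift R | forall i, y i -> P i].
Proof.
split; first by exists (SparseSeq R sparse0).
apply: closed_agree => y yP i yi; have [z zP yz] := yP i.+1.
by apply: zP; rewrite -yz.
Qed.

Definition support_set (P : nat -> bool) : hyper_tds (sparse_shift R) :=
  Hyperspace (support_set_subproof P).1 (support_set_subproof P).2.

Lemma support_set_dist (P Q : nat -> bool) i : P i != Q i ->
  1 <= orbit_dist (support_set P) (support_set Q) i.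
Proof.
wlog [Pi Qi] : P Q / P i /\ ~~ Q i.
  move=> h PQ; case Pi : (P i) (PQ) => Qi.
    by apply: h => //; rewrite Pi; case: (Q i) Qi.
  rewrite /orbit_dist metric_sym; apply: h; last by rewrite eq_sym.
  by rewrite Pi; case: (Q i) Qi.
move=> _; apply: hyper_orbit_dist_ge1.
  exists (SparseSeq R (sparse_single i)) => /=; last exact: eqxx.
  by move=> j /eqP ->.
by move=> y /(_ i) yQ; apply: contra Qi.
Qed.

Lemma hyper_entropy_gt0 :
  (0 < topological_entropy (hyper_tds (sparse_shift R)))%E.
Proof.
have ln20 : 0 < ln 2 :> R by rewrite ln_gt0// ltr1n.
apply: (@lt_le_trans _ _ (ln 2)%:E); first by rewrite lte_fin.
apply: le_ereal_sup_tmp; eexists.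
  by exists 2^-1 => /=; [rewrite invr_gt0|reflexivity].
apply: (@limn_esup_ge _ _ 1) => n n0.
pose f (s : {set 'I_n}) := support_set (fun i => i \in [seq val j | j in s]).
have fdist s1 s2 : s1 != s2 ->
    exists2 i, (i < n)%N & 1 <= orbit_dist (f s1) (f s2) i.
  move=> s12; have [i si] : exists i : 'I_n, (i \in s1) != (i \in s2).
    apply/existsP; apply: contraNT s12 => /existsPn h.
    by apply/eqP/setP => i; apply/eqP; rewrite -[_ == _]negbK; exact: h.
  exists i => //; apply: support_set_dist.
  by rewrite !(fintype.mem_image val_inj).
have finj : injective f.
  move=> s1 s2 f12; apply/eqP; apply: contraT => /fdist[i _].
  by rewrite f12 /orbit_dist mdistxx ler10.
pose A : {fset hyper_tds (sparse_shift R)} :=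
  [fset f s | s in {: {set 'I_n}}]%fset.
have cardA : #|` A| = (2 ^ n)%N.
  rewrite card_imfset// -cardE -cardsT -powersetT.
  by rewrite card_powerset cardsT card_ord.
have sepA : Defs.separated n 2^-1 A.
  move=> _ _ /imfsetP[s1 _ ->] /imfsetP[s2 _ ->] f12.
  have [|i i_n d1] := fdist s1 s2; first by apply: contraNneq f12 => ->.
  by exists i => //; apply: lt_le_trans d1; rewrite invf_lt1// ltr1n.
apply: (@le_trans _ _ ((n%:R^-1)%:E * lne ((2 ^ n)%:R%:E))%E).
  rewrite lne_EFin; last by rewrite ltr0n expn_gt0.
  rewrite natrX lnXn// -EFinM lee_fin -[ln 2 *+ n]mulr_natl.
  rewrite mulrA mulVf ?mul1r//.
  by rewrite pnatr_eq0 -lt0n.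
apply: lee_wpmul2l; first by rewrite lee_fin invr_ge0.
rewrite lee_lne ?in_itv /= ?leey ?andbT ?lee_fin//.
- by apply: ereal_sup_ubound; exists A => //; rewrite cardA.
- by rewrite (le_trans _ (max_separated_ge1 _ _ _)).
Qed.

(** Both approximations of C at once: with the flag b the sequences vanish from
    coordinate N on, and without it they continue freely, so that a one may be
    put at any late enough coordinate. *)
Definition tails (b : bool) N (C : set X) : set (sparse_shift R) :=
  [set y | (exists2 x, C x & agree N x y) /\
           (b -> forall i, (N <= i)%N -> ~~ y i)].

Lemma closed_tails b N C : closed (tails b N C).
Proof.
apply: closed_agree => y yC; split.
  have [z [[x Cx xz] _] yz] := yC N; exists x => // i iN.
  by rewrite xz// yz.
move=> hb i Ni; have [z [_ /(_ hb i Ni) zi] ->//] := yC i.+1.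
Qed.

Lemma truncate_tails b N (C : set X) x : C x ->
  exists2 y, tails b N C y & agree N x y.
Proof.
move=> Cx; have ts : sparse (fun i => (i < N)%N && x i).
  by apply: sparse_sub (bits_sparse x) => i /andP[].
have xt : agree N x (SparseSeq R ts) by move=> i /= ->.
exists (SparseSeq R ts) => //; split; first by exists x.
by move=> _ i /= Ni; rewrite ltnNge Ni.
Qed.

Lemma tails_neq0 b N (C : hyperspace (sparse_shift R)) : tails b N C !=set0.
Proof.
have [x Cx] : exists x, hset C x by case: C.
by have [y ty _] := truncate_tails b N Cx; exists y.
Qed.

Definition htails b N (C : hyperspace (sparse_shift R)) :
    hyper_tds (sparse_shift R) :=
  Hyperspace (tails_neq0 b N C) (@closed_tails b N C).

Lemma htails_dist b N (C : hyper_tds (sparse_shift R)) :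
  mdist C (htails b N C) <= N.+1%:R^-1.
Proof.
apply: hausdorff_dist_le => x.
  move=> /(truncate_tails b N)[y ty xy]; exists y => //; exact: seq_dist_le.
move=> [[y Cy yx] _]; exists y => //; apply: seq_dist_le => i iN.
by rewrite yx.
Qed.

(** Every closed set C is approximated both by a set all of whose elements
    eventually vanish, and by a set having, for each large i, an element with a
    one at coordinate i: the orbits of the two approximations stay at distance 1
    from some time on. *)
Lemma hyper_mean_sensitive : mean_sensitive (hyper_tds (sparse_shift R)).
Proof.
exists 2^-1; first by rewrite invr_gt0.
move=> U oU [C UC].
have /nbhs_ballP[e /= e0 eU] := open_nbhs_nbhs (conj oU UC).
(* N is positive so that a block of length N has room for an isolated one. *)
have [N0 N0e] := exists_natSinv_lt e0; pose N := N0.+1.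
have UN b : U (htails b N C).
  apply: eU; rewrite ballEmdist /=; apply: le_lt_trans (htails_dist _ _ _) _.
  by apply: le_lt_trans N0e; rewrite lef_pV2 ?posrE// ler_nat.
exists (htails false N C), (htails true N C); split => //.
pose i0 := (N + (N + N) ^ 2)%N.
have far i : (i0 <= i)%N ->
    1 <= orbit_dist (htails false N C) (htails true N C) i.
  move=> i0i; apply: hyper_orbit_dist_ge1; last first.
    by move=> y [_ /(_ isT)]; apply; rewrite (leq_trans _ i0i)// leq_addr.
  have [x Cx] : exists x, hset C x by case: (C).
  exists (glue_seq x (SparseSeq R (sparse_single 0)) i0i).
    split => //; exists x => // j jN; rewrite /= /glue_bits jN leqNgt.
    by rewrite (leq_trans jN (leq_trans (leq_addr _ _) i0i)) orbF.
  by rewrite /= /glue_bits leqnn subnn eqxx -addn1 leq_add2l orbT.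
(* The orbits are far apart at all but the first i0 <= n / 4 times. *)
apply: (@lt_le_trans _ _ (3 / 4)%:E); first by rewrite lte_fin; lra.
apply: (@limn_esup_ge _ _ (4 * i0).+1) => n n4.
have n_gt0 : 0 < n%:R :> R by rewrite ltr0n (leq_trans _ n4).
rewrite lee_fin ler_pdivlMl//.
have i0n : (i0 <= n)%N by lia.
rewrite (big_cat_nat (leq0n i0) i0n) /=.
apply: (@le_trans _ _ (0 + \sum_(i0 <= i < n) 1)); last first.
  apply: lerD; first by apply: sumr_ge0 => i _; exact: mdist_ge0.
  by apply: ler_sum_nat => i /andP[/far].
rewrite add0r sumr_const_nat natrB//.
have : (4 * i0)%:R <= n%:R :> R by rewrite ler_nat ltnW.
by rewrite natrM; lra.
Qed.

End dynamics.

Local Open Scope ereal_scope.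

Theorem theorem1p8 (R : realType) :
  exists S : tds R,
    transitive_tds S /\
    topological_entropy S = 0 /\
    Banach_mean_equicontinuous S /\
    ~ mean_sensitive S /\
    mean_sensitive (hyper_tds S) /\
    0 < topological_entropy (hyper_tds S).
Proof.
exists (sparse_shift R); split; first exact: sparse_shift_transitive.
split; first exact: sparse_shift_entropy0.
split; first exact: sparse_shift_equicontinuous.
split; first exact: sparse_shift_not_sensitive.
by split; [exact: hyper_mean_sensitive|exact: hyper_entropy_gt0].
Qed.
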